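(* For all integers $m,n\ge0$, the bicomplex Hermite polynomial $H_{m,n}(Z,Z^* )$ is an eigenfunction of the bicomplex Landau operator $\mathcal{G}_*$; namely, for all $Z\in\mathbb{BC}$, $$\mathcal{G}_*(H_{m,n})(Z,Z^* )=n\,H_{m,n}(Z,Z^* ).$$
   Context: Bicomplex numbers: $\mathbb{BC}$ is the commutative real algebra generated by two commuting imaginary units $\mathbf{i},\mathbf{j}$ ($\mathbf{i}^2=\mathbf{j}^2=-1$), with $\mathbf{k}=\mathbf{i}\mathbf{j}$, $\mathbf{k}^2=1$. Put $\mathbf{e}_1=\frac{1+\mathbf{k}}{2}$, $\mathbf{e}_2=\frac{1-\mathbf{k}}{2}$ (idempotents with $\mathbf{e}_1\mathbf{e}_2=0$, $\mathbf{e}_1+\mathbf{e}_2=1$). Each $Z=z_1+\mathbf{j}z_2$ with $z_1,z_2\in\mathbb{C}=\mathbb{C}(\mathbf{i})$ is uniquely $Z=\lambda_1\mathbf{e}_1+\lambda_2\mathbf{e}_2$ with $\lambda_1=z_1-\mathbf{i}z_2$, $\lambda_2=z_1+\mathbf{i}z_2\in\mathbb{C}$. The $*$-conjugate is $Z^*=\overline{z_1}-\mathbf{j}\overline{z_2}=\overline{\lambda_1}\mathbf{e}_1+\overline{\lambda_2}\mathbf{e}_2$. Differential operators: $\frac{\partial}{\partial Z}=\partial_{\lambda_1}\mathbf{e}_1+\partial_{\lambda_2}\mathbf{e}_2$ and $\frac{\partial}{\partial Z^*}=\partial_{\overline{\lambda_1}}\mathbf{e}_1+\partial_{\overline{\lambda_2}}\mathbf{e}_2$,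 with $\partial_\lambda,\partial_{\overline\lambda}$ the usual Wirtinger derivatives, acting componentwise on smooth $f=f_1\mathbf{e}_1+f_2\mathbf{e}_2$ (with $f_1,f_2$ complex-valued), i.e. $\frac{\partial f}{\partial Z}=(\partial_{\lambda_1}f_1)\mathbf{e}_1+(\partial_{\lambda_2}f_2)\mathbf{e}_2$ and $\frac{\partial f}{\partial Z^*}=(\partial_{\overline{\lambda_1}}f_1)\mathbf{e}_1+(\partial_{\overline{\lambda_2}}f_2)\mathbf{e}_2$. The bicomplex Laplacian with respect to $\mathbf{k}$ is $\Delta_{\mathbf{k}}=\frac{\partial^2}{\partial Z\,\partial Z^*}$, and the bicomplex Landau operator is $$\mathcal{G}_*=-\Delta_{\mathbf{k}}+Z^*\frac{\partial}{\partial Z^*}.$$ The $Z^*$-bicomplex Hermite polynomials of the first kind are, for integers $m,n\ge0$, $$H_{m,n}(Z,Z^* )=\sum_{k=0}^{\min(m,n)}(-1)^k k!\binom{m}{k}\binom{n}{k}Z^{m-k}(Z^* )^{n-k}.$$ *)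

(* Defs.v *)
From HB Require Import structures.
From mathcomp Require Import all_boot all_order all_algebra.
From mathcomp Require Import complex ring.
From mathcomp Require Import all_classical all_reals all_analysis.

Set Implicit Arguments.
Unset Strict Implicit.
Unset Printing Implicit Defensive.

Import Order.TTheory GRing.Theory Num.Theory.
Import numFieldNormedType.Exports.

Local Open Scope ring_scope.
Local Open Scope complex_scope.

(* [Bicomplex z1 z2] stands for z1 + j z2, with z1, z2 in C(i) = R[i]. *)
Record bicomplex (R : realType) := Bicomplex { bc1 : R[i]; bc2 : R[i] }.

Section Algebra.
Context {R : realType}.
Local Notation BC := (bicomplex R).
Implicit Types (Z W : BC) (a l : R[i]).

Definition bc_to_pair Z := (bc1 Z, bc2 Z).
Definition bc_of_pair (p : R[i] * R[i]) : BC := Bicomplex p.1 p.2.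
Lemma bc_to_pairK : cancel bc_to_pair bc_of_pair. Proof. by case. Qed.
HB.instance Definition _ := Choice.copy BC (can_type bc_to_pairK).

Lemma bc_ext Z W : bc1 Z = bc1 W -> bc2 Z = bc2 W -> Z = W.
Proof. by case: Z W => [a b] [c d] /= -> ->. Qed.

Definition bc_add Z W : BC := Bicomplex (bc1 Z + bc1 W) (bc2 Z + bc2 W).
Definition bc_opp Z : BC := Bicomplex (- bc1 Z) (- bc2 Z).
Definition bc_mul Z W : BC :=
  Bicomplex (bc1 Z * bc1 W - bc2 Z * bc2 W) (bc1 Z * bc2 W + bc2 Z * bc1 W).
Definition bc_scale a Z : BC := Bicomplex (a * bc1 Z) (a * bc2 Z).

Lemma bc_addA : associative bc_add.
Proof. by move=> x y z; apply: bc_ext; rewrite /= addrA. Qed.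
Lemma bc_addC : commutative bc_add.
Proof. by move=> x y; apply: bc_ext; rewrite /= addrC. Qed.
Lemma bc_add0 : left_id (Bicomplex 0 0) bc_add.
Proof. by move=> x; apply: bc_ext; rewrite /= add0r. Qed.
Lemma bc_addN : left_inverse (Bicomplex 0 0) bc_opp bc_add.
Proof. by move=> x; apply: bc_ext; rewrite /= addNr. Qed.
HB.instance Definition _ :=
  GRing.isZmodule.Build BC bc_addA bc_addC bc_add0 bc_addN.

Lemma bc_mulA : associative bc_mul.
Proof. by move=> x y z; apply: bc_ext => /=; ring. Qed.
Lemma bc_mulC : commutative bc_mul.
Proof. by move=> x y; apply: bc_ext => /=; ring. Qed.
Lemma bc_mul1 : left_id (Bicomplex 1 0) bc_mul.
Proof. by move=> x; apply: bc_ext => /=; ring. Qed.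
Lemma bc_mulDl : left_distributive bc_mul +%R.
Proof. by move=> x y z; apply: bc_ext => /=; ring. Qed.
Lemma bc_one_neq0 : Bicomplex 1 0 != 0 :> BC.
Proof. by apply/eqP => -[] /eqP; rewrite oner_eq0. Qed.
HB.instance Definition _ := GRing.Zmodule_isComNzRing.Build BC
  bc_mulA bc_mulC bc_mul1 bc_mulDl bc_one_neq0.

Lemma bc_scaleA a b Z : bc_scale a (bc_scale b Z) = bc_scale (a * b) Z.
Proof. by apply: bc_ext => /=; rewrite mulrA. Qed.
Lemma bc_scale1 : left_id 1 bc_scale.
Proof. by move=> x; apply: bc_ext => /=; rewrite mul1r. Qed.
Lemma bc_scaleDr : right_distributive bc_scale +%R.
Proof. by move=> a x y; apply: bc_ext => /=; rewrite mulrDr. Qed.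
Lemma bc_scaleDl Z : {morph bc_scale^~ Z : a b / a + b}.
Proof. by move=> a b; apply: bc_ext => /=; rewrite mulrDl. Qed.
HB.instance Definition _ := GRing.Zmodule_isLmodule.Build R[i] BC
  bc_scaleA bc_scale1 bc_scaleDr bc_scaleDl.

Lemma bc_scaleAl a Z W : a *: (Z * W) = a *: Z * W.
Proof. by apply: bc_ext => /=; ring. Qed.
HB.instance Definition _ := GRing.Lmodule_isLalgebra.Build R[i] BC bc_scaleAl.
Lemma bc_scaleAr a Z W : a *: (Z * W) = Z * (a *: W).
Proof. by apply: bc_ext => /=; ring. Qed.
HB.instance Definition _ := GRing.Lalgebra_isAlgebra.Build R[i] BC bc_scaleAr.

Definition bci : BC := 'i%C%:A.
Definition bcj : BC := Bicomplex 0 1.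
Definition bck : BC := bci * bcj.

Definition bce1 : BC := 2^-1 *: (1 + bck).
Definition bce2 : BC := 2^-1 *: (1 - bck).

Definition idem1 Z : R[i] := bc1 Z - 'i%C * bc2 Z.
Definition idem2 Z : R[i] := bc1 Z + 'i%C * bc2 Z.

Definition of_idem l1 l2 : BC := l1 *: bce1 + l2 *: bce2.

Definition bc_conj Z : BC := Bicomplex (conjc (bc1 Z)) (- conjc (bc2 Z)).

Lemma mulc_ii : ('i%C * 'i%C : R[i]) = -1.
Proof. by rewrite -expr2 complex.sqr_i. Qed.

Lemma bcj_sqr : bcj * bcj = -1.
Proof. by apply: bc_ext => /=; ring. Qed.

Lemma bck_sqr : bck * bck = 1.
Proof.
rewrite /bck (_ : _ * _ = (bci * bci) * (bcj * bcj)); last by ring.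
by rewrite bcj_sqr /bci -scalerAl mul1r scalerA mulc_ii scaleN1r mulrNN mulr1.
Qed.

Lemma bce1D2 : bce1 + bce2 = 1 :> BC.
Proof. by apply: bc_ext => /=; field. Qed.

Lemma bce1M2 : bce1 * bce2 = 0 :> BC.
Proof.
rewrite /bce1 /bce2 -scalerAl -scalerAr.
rewrite (_ : (1 + bck) * (1 - bck) = 1 - bck * bck); last by ring.
by rewrite bck_sqr subrr !scaler0.
Qed.

Lemma of_idemE l1 l2 :
  of_idem l1 l2 = Bicomplex ((l1 + l2) / 2) ('i%C * (l1 - l2) / 2).
Proof. by apply: bc_ext => /=; field. Qed.

Lemma of_idemK Z : of_idem (idem1 Z) (idem2 Z) = Z.
Proof.
rewrite of_idemE; apply: bc_ext => /=; rewrite /idem1 /idem2; first by field.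
rewrite (_ : 'i%C * _ / 2 = - ('i%C * 'i%C) * bc2 Z); last by field.
by rewrite mulc_ii opprK mul1r.
Qed.

Lemma idem1K l1 l2 : idem1 (of_idem l1 l2) = l1.
Proof.
rewrite of_idemE /idem1 /=.
rewrite (_ : _ - _ = (l1 + l2) / 2 - 'i%C * 'i%C * (l1 - l2) / 2); last by field.
by rewrite mulc_ii; field.
Qed.

Lemma idem2K l1 l2 : idem2 (of_idem l1 l2) = l2.
Proof.
rewrite of_idemE /idem2 /=.
rewrite (_ : _ + _ = (l1 + l2) / 2 + 'i%C * 'i%C * (l1 - l2) / 2); last by field.
by rewrite mulc_ii; field.
Qed.

Lemma bc_conjE Z : bc_conj Z = of_idem (conjc (idem1 Z)) (conjc (idem2 Z)).
Proof.
have iC a b : conjc (a + 'i%C * b) = conjc a - 'i%C * conjc b.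
  by case: a b => [? ?] [? ?]; simpc.
case: Z => [z1 z2]; rewrite -[LHS]of_idemK /idem1 /idem2; congr of_idem.
  by rewrite -[in RHS]mulrN iC rmorphN.
by rewrite iC -mulrN.
Qed.

End Algebra.

Section Wirtinger.
Context {R : realType}.
Implicit Types (g : R[i] -> R[i]) (z : R[i]).

Definition partial_x g z : R[i] :=
  derive1 (fun t : R => complex.Re (g (t +i* complex.Im z))) (complex.Re z)
  +i* derive1 (fun t : R => complex.Im (g (t +i* complex.Im z))) (complex.Re z).

Definition partial_y g z : R[i] :=
  derive1 (fun t : R => complex.Re (g (complex.Re z +i* t))) (complex.Im z)
  +i* derive1 (fun t : R => complex.Im (g (complex.Re z +i* t))) (complex.Im z).

Definition wirtinger g z : R[i] := (partial_x g z - 'i%C * partial_y g z) / 2.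
Definition wirtinger_bar g z : R[i] := (partial_x g z + 'i%C * partial_y g z) / 2.

End Wirtinger.

Section Operators.
Context {R : realType}.
Local Notation BC := (bicomplex R).
Implicit Types (f : BC -> BC) (Z : BC).

Definition d_dZ f Z : BC := of_idem
  (wirtinger (fun l => idem1 (f (of_idem l (idem2 Z)))) (idem1 Z))
  (wirtinger (fun l => idem2 (f (of_idem (idem1 Z) l))) (idem2 Z)).

Definition d_dZstar f Z : BC := of_idem
  (wirtinger_bar (fun l => idem1 (f (of_idem l (idem2 Z)))) (idem1 Z))
  (wirtinger_bar (fun l => idem2 (f (of_idem (idem1 Z) l))) (idem2 Z)).

Definition laplacian_k f : BC -> BC := d_dZ (d_dZstar f).

Definition landau f Z : BC := - laplacian_k f Z + bc_conj Z * d_dZstar f Z.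

(* C^n regularity of a real function on R^4; all orders together give
   C^infinity. *)
Fixpoint Cn (n : nat) (u : 'rV[R]_4 -> R) : Prop :=
  if n is p.+1 then
    (forall x, differentiable u x) /\
    (forall i : 'I_4, Cn p (fun x => 'D_(delta_mx ord0 i) u x))
  else continuous u.

Definition bc_of_real (x : 'rV[R]_4) : BC :=
  Bicomplex (x ord0 (inord 0) +i* x ord0 (inord 1))
            (x ord0 (inord 2) +i* x ord0 (inord 3)).

(* Under BC = R^4, the four real coordinates of f are C^infinity. *)
Definition bc_smooth f : Prop := forall n : nat,
  [/\ Cn n (fun x => complex.Re (bc1 (f (bc_of_real x)))),
      Cn n (fun x => complex.Im (bc1 (f (bc_of_real x)))),
      Cn n (fun x => complex.Re (bc2 (f (bc_of_real x)))) &
      Cn n (fun x => complex.Im (bc2 (f (bc_of_real x))))].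

(* The operators above are built on a total derivative, with no meaning where
   f is not differentiable; hence an eigenfunction of G is required to lie in
   the domain of smooth functions, and, as usual, not to vanish identically. *)
Definition eigenfunction (G : (BC -> BC) -> BC -> BC) (a : BC) f : Prop :=
  [/\ bc_smooth f, exists Z, f Z != 0 & forall Z, G f Z = a * f Z].

Definition hermite (m n : nat) (Z : BC) : BC :=
  \sum_(k < (minn m n).+1)
    (-1) ^+ k * (k`! * 'C(m, k) * 'C(n, k))%:R
    * Z ^+ (m - k) * bc_conj Z ^+ (n - k).

End Operators.

(* Main.v *)
Require Import Defs.
From HB Require Import structures.
From mathcomp Require Import all_boot all_order all_algebra.
From mathcomp Require Import complex ring.
From mathcomp Require Import all_classical all_reals all_analysis.

(** In the idempotent coordinates (lambda_1, lambda_2) everything decouples: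
    [idem1] and [idem2] are ring morphisms onto the complex numbers, they turn
    the star-conjugate into complex conjugation, and the operators of the
    statement act on each coordinate as one-variable Wirtinger derivatives.
    Since the coefficients of the Hermite polynomial are integers, it is the
    lift ([bc_lift]) of the one-variable complex Hermite polynomial h_{m,n},
    placed in both coordinates. The Landau operator therefore reduces to
    - d dbar + zbar dbar acting on h_{m,n} ([landau_lift]).

    In one variable three identities suffice. Comparing coefficients,
      d h_{m,n} = m h_{m-1,n}      ([wirtinger_complex_hermite]),
      dbar h_{m,n} = n h_{m,n-1}   ([wirtinger_bar_complex_hermite]),
      h_{m,n+1} = zbar h_{m,n} - m h_{m-1,n}   ([complex_hermite_rec]),
    so that (- d dbar + zbar dbar) h_{m,n}
      = n (zbar h_{m,n-1} - m h_{m-1,n-1}) = n h_{m,n}.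

    An eigenfunction must also be smooth and not identically zero. Smoothness
    holds because the C^p functions are stable under the ring operations and
    contain the coordinates. For the second point, dbar lowers n: if h_{m,n+1}
    vanished identically then so would h_{m,n}, and finally h_{m,0} = z^m,
    which is 1 at z = 1. *)

Import Order.TTheory GRing.Theory Num.Theory.
Import numFieldNormedType.Exports.
Local Open Scope ring_scope.

(** * Smoothness of bicomplex polynomials *)

Section Smooth.
Local Open Scope complex_scope.
Set Implicit Arguments.
Unset Strict Implicit.
Context {R : realType}.
Implicit Types u v : 'rV[R]_4 -> R.

Lemma CnW p u : Cn p.+1 u -> Cn p u.
Proof.
elim: p u => [|p IH] u [du Du]; first by move=> x; exact: differentiable_continuous.
by split=> // i; apply: IH; exact: Du.
Qed.

Lemma Cn_cst p (c : R) : Cn p (fun=> c : R).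
Proof.
elim: p c => [|p IH] c /=; first by move=> x; exact: cst_continuous.
split=> [x|i]; first exact: differentiable_cst.
have -> : (fun x : 'rV[R]_4 => 'D_(delta_mx ord0 i) (fun=> c) x) = (fun=> 0 : R).
  by apply/funext => x; rewrite derive_cst.
exact: IH.
Qed.

Lemma Cn_coord p (j : 'I_4) : Cn p (fun x : 'rV[R]_4 => x ord0 j).
Proof.
case: p => [|p] /=; first by move=> x; exact: coord_continuous.
split=> [x|i]; first exact: differentiable_coord.
have -> : (fun x => 'D_(delta_mx ord0 i) (fun x : 'rV[R]_4 => x ord0 j) x) =
    fun=> (delta_mx ord0 i : 'rV[R]_4) ord0 j.
  apply/funext => x; rewrite deriveE; last exact: differentiable_coord.
  have lin_coord : linear (fun y : 'rV[R]_4 => y ord0 j : R) by move=> a y z; rewrite !mxE.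
  pose L := GRing.isLinear.Build R 'rV[R]_4 R *:%R (fun y : 'rV[R]_4 => y ord0 j) lin_coord.
  pose f : {linear 'rV[R]_4 -> R} := HB.pack (fun y : 'rV[R]_4 => y ord0 j : R) L.
  by rewrite (_ : (fun y : 'rV[R]_4 => y ord0 j) = f) // diff_lin //; exact: coord_continuous.
exact: Cn_cst.
Qed.

Lemma CnD p u v : Cn p u -> Cn p v -> Cn p (fun x => u x + v x).
Proof.
elim: p u v => [|p IH] u v; first by move=> cu cv x; exact: cvgD (cu x) (cv x).
move=> [du Du] [dv Dv]; split=> [x|i]; first exact: differentiableD.
have -> : (fun x => 'D_(delta_mx ord0 i) (fun y => u y + v y) x) =
  (fun x => 'D_(delta_mx ord0 i) u x + 'D_(delta_mx ord0 i) v x).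
  by apply/funext => x; rewrite deriveD //; exact: diff_derivable.
exact: IH (Du i) (Dv i).
Qed.

(** By Leibniz each partial of a product involves the factors themselves as
    well as their partials, hence the descent [CnW] from order p.+1 to p. *)
Lemma CnM p u v : Cn p u -> Cn p v -> Cn p (fun x => u x * v x).
Proof.
elim: p u v => [|p IH] u v; first by move=> cu cv x; exact: cvgM (cu x) (cv x).
move=> Cu Cv; have [du Du] := Cu; have [dv Dv] := Cv.
split=> [x|i]; first exact: differentiableM.
have -> : (fun x => 'D_(delta_mx ord0 i) (fun y => u y * v y) x) =
  (fun x => u x * 'D_(delta_mx ord0 i) v x + v x * 'D_(delta_mx ord0 i) u x).
  by apply/funext => x; rewrite deriveM //; exact: diff_derivable.
apply: CnD; [exact: IH (CnW Cu) (Dv i) | exact: IH (CnW Cv) (Du i)].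
Qed.

Lemma CnN p u : Cn p u -> Cn p (fun x => - u x).
Proof.
move=> Cu; have -> : (fun x => - u x) = (fun x => -1 * u x).
  by apply/funext => x; rewrite mulN1r.
by apply: CnM => //; exact: Cn_cst.
Qed.

Definition Cn_complex p (g : 'rV[R]_4 -> R[i]) :=
  Cn p (fun x => complex.Re (g x)) /\ Cn p (fun x => complex.Im (g x)).

Lemma Cn_complexD p g h : Cn_complex p g -> Cn_complex p h ->
  Cn_complex p (fun x => g x + h x).
Proof.
move=> [gr gi] [hr hi]; split.
  by have := CnD gr hr; congr Cn; apply/funext => x; case: (g x) (h x) => ? ? [].
by have := CnD gi hi; congr Cn; apply/funext => x; case: (g x) (h x) => ? ? [].
Qed.

Lemma Cn_complexN p g : Cn_complex p g -> Cn_complex p (fun x => - g x).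
Proof.
move=> [gr gi]; split.
  by have := CnN gr; congr Cn; apply/funext => x; case: (g x).
by have := CnN gi; congr Cn; apply/funext => x; case: (g x).
Qed.

Lemma Cn_complexM p g h : Cn_complex p g -> Cn_complex p h ->
  Cn_complex p (fun x => g x * h x).
Proof.
move=> [gr gi] [hr hi]; split.
  have := CnD (CnM gr hr) (CnN (CnM gi hi)).
  by congr Cn; apply/funext => x; case: (g x) (h x) => ? ? [].
have := CnD (CnM gr hi) (CnM gi hr).
by congr Cn; apply/funext => x; case: (g x) (h x) => ? ? [].
Qed.

Definition Cn_bc p (f : 'rV[R]_4 -> bicomplex R) :=
  Cn_complex p (fun x => bc1 (f x)) /\ Cn_complex p (fun x => bc2 (f x)).

Lemma Cn_bc_cst p (W : bicomplex R) : Cn_bc p (fun=> W).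
Proof. by do 2 split; exact: Cn_cst. Qed.

Lemma Cn_bc_id p : Cn_bc p (@bc_of_real R).
Proof. by do 2 split; exact: Cn_coord. Qed.

Lemma Cn_bc_conj p : Cn_bc p (fun x => bc_conj (@bc_of_real R x)).
Proof.
split; split => /=; rewrite ?oppr0;
  first [exact: Cn_coord | apply: CnN; exact: Cn_coord | idtac].
(* The fourth coordinate is negated twice, by conjugation and by - j. *)
have := Cn_coord p (inord 3); congr Cn; apply/funext => x; exact/esym/opprK.
Qed.

Lemma Cn_bcD p f g : Cn_bc p f -> Cn_bc p g -> Cn_bc p (fun x => f x + g x).
Proof. by move=> [f1 f2] [g1 g2]; split; exact: Cn_complexD. Qed.

Lemma Cn_bcM p f g : Cn_bc p f -> Cn_bc p g -> Cn_bc p (fun x => f x * g x).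
Proof.
move=> [f1 f2] [g1 g2]; split; apply: Cn_complexD; try apply: Cn_complexN;
  exact: Cn_complexM.
Qed.

Lemma Cn_bcX p f k : Cn_bc p f -> Cn_bc p (fun x => f x ^+ k).
Proof.
move=> Cf; elim: k => [|k IH]; first exact: Cn_bc_cst.
have -> : (fun x => f x ^+ k.+1) = fun x => f x * f x ^+ k.
  by apply/funext => x; rewrite exprS.
exact: Cn_bcM.
Qed.

Lemma Cn_bc_sum p (I : Type) (r : seq I) (f : I -> 'rV[R]_4 -> bicomplex R) :
  (forall i, Cn_bc p (f i)) -> Cn_bc p (fun x => \sum_(i <- r) f i x).
Proof.
move=> Cf; elim: r => [|i r IH].
  have -> : (fun x => \sum_(i <- [::]) f i x) = fun=> 0.
    by apply/funext => x; rewrite big_nil.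
  exact: Cn_bc_cst.
have -> : (fun x => \sum_(j <- i :: r) f j x) = fun x => f i x + \sum_(j <- r) f j x.
  by apply/funext => x; rewrite big_cons.
exact: Cn_bcD.
Qed.

Lemma bc_smooth_hermite m n : bc_smooth (@hermite R m n).
Proof.
move=> p; suff [[? ?] [? ?]] : Cn_bc p (fun x => hermite m n (bc_of_real x)) by split.
apply: Cn_bc_sum => k; apply: Cn_bcM; last by apply: Cn_bcX; exact: Cn_bc_conj.
by apply: Cn_bcM; [exact: Cn_bc_cst | apply: Cn_bcX; exact: Cn_bc_id].
Qed.

End Smooth.

(** * Wirtinger calculus on the complex plane *)

Section Wirtinger.
Local Open Scope complex_scope.
Set Implicit Arguments.
Unset Strict Implicit.
Context {R : realType}.
Local Notation C := R[i].
Implicit Types (phi psi : R -> C) (g h : C -> C) (z : C).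

(** Derivative of a curve in the complex plane, taken on the real and
    imaginary parts, which is how the Wirtinger derivatives are built. *)
Definition is_cderive phi (t : R) (l : C) : Prop :=
  is_derive t 1 (fun s => complex.Re (phi s)) (complex.Re l) /\
  is_derive t 1 (fun s => complex.Im (phi s)) (complex.Im l).

Lemma is_cderive_derive1 phi t l : is_cderive phi t l ->
  derive1 (fun s => complex.Re (phi s)) t
    +i* derive1 (fun s => complex.Im (phi s)) t = l.
Proof. by move=> [dr di]; rewrite !derive1E !derive_val; case: l {dr di}. Qed.

Lemma is_cderiveD phi psi t a b : is_cderive phi t a -> is_cderive psi t b ->
  is_cderive (fun s => phi s + psi s) t (a + b).
Proof.
move=> [pr pi] [qr qi]; split.
  have := is_deriveD pr qr.
  by congr is_derive; [apply/funext => s; rewrite /= raddfD|rewrite raddfD].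
have := is_deriveD pi qi.
by congr is_derive; [apply/funext => s; rewrite /= raddfD|rewrite raddfD].
Qed.

Lemma is_cderiveM phi psi t a b : is_cderive phi t a -> is_cderive psi t b ->
  is_cderive (fun s => phi s * psi s) t (a * psi t + phi t * b).
Proof.
have ReM (x y : C) : complex.Re (x * y) =
  complex.Re x * complex.Re y - complex.Im x * complex.Im y.
  by case: x y => ? ? [? ?].
have ImM (x y : C) : complex.Im (x * y) =
  complex.Re x * complex.Im y + complex.Im x * complex.Re y.
  by case: x y => ? ? [? ?].
have ReD (x y : C) : complex.Re (x + y) = complex.Re x + complex.Re y.
  by case: x y => ? ? [? ?].
have ImD (x y : C) : complex.Im (x + y) = complex.Im x + complex.Im y.
  by case: x y => ? ? [? ?].
move=> [pr pi] [qr qi]; split.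
  have := is_deriveB (is_deriveM pr qr) (is_deriveM pi qi).
  congr is_derive; first by apply/funext => s; rewrite /= ReM.
  by rewrite ReD !ReM /GRing.scale /=; ring.
have := is_deriveD (is_deriveM pr qi) (is_deriveM pi qr).
congr is_derive; first by apply/funext => s; rewrite /= ImM.
by rewrite ImD !ImM /GRing.scale /=; ring.
Qed.

(** Existence of both partial derivatives, recorded through the values
    a = d g and b = dbar g: from these, d_x g = a + b and d_y g = i (a - b).
    The Wirtinger operators are total and are only additive and Leibniz where
    the partials exist, so existence has to be carried along with the values. *)
Definition has_wirtinger g z a b : Prop :=
  is_cderive (fun t => g (t +i* complex.Im z)) (complex.Re z) (a + b) /\
  is_cderive (fun t => g (complex.Re z +i* t)) (complex.Im z) ('i%C * (a - b)).

Lemma has_wirtingerE g z a b : has_wirtinger g z a b -> wirtinger g z = a.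
Proof.
move=> [/is_cderive_derive1 dx /is_cderive_derive1 dy].
rewrite /wirtinger /partial_x /partial_y dx dy mulrA mulc_ii.
by field.
Qed.

Lemma has_wirtinger_barE g z a b :
  has_wirtinger g z a b -> wirtinger_bar g z = b.
Proof.
move=> [/is_cderive_derive1 dx /is_cderive_derive1 dy].
rewrite /wirtinger_bar /partial_x /partial_y dx dy mulrA mulc_ii.
by field.
Qed.

Lemma has_wirtinger_cst c z : has_wirtinger (fun=> c) z 0 0.
Proof. by rewrite /has_wirtinger addr0 subr0 mulr0; do 2 split; exact: is_derive_cst. Qed.

Lemma has_wirtinger_id z : has_wirtinger id z 1 0.
Proof.
rewrite /has_wirtinger addr0 subr0 mulr1.
by do 2 split => /=; (exact: is_derive_cst || exact: is_derive_id).
Qed.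

Lemma has_wirtinger_conj z : has_wirtinger (@conjc R) z 0 1.
Proof.
rewrite /has_wirtinger add0r sub0r mulrN1; split; split => /=.
- exact: is_derive_id.
- exact: is_derive_cst.
- rewrite oppr0; exact: is_derive_cst.
- exact: is_deriveN.
Qed.

Lemma has_wirtingerD g h z a b c d :
  has_wirtinger g z a b -> has_wirtinger h z c d ->
  has_wirtinger (fun w => g w + h w) z (a + c) (b + d).
Proof.
move=> [gx gy] [hx hy]; split.
  by rewrite addrACA; exact: is_cderiveD.
rewrite (_ : 'i%C * _ = 'i%C * (a - b) + 'i%C * (c - d)); last by ring.
exact: is_cderiveD.
Qed.

Lemma has_wirtingerM g h z a b c d :
  has_wirtinger g z a b -> has_wirtinger h z c d ->
  has_wirtinger (fun w => g w * h w) z (a * h z + g z * c) (b * h z + g z * d).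
Proof.
move=> [gx gy] [hx hy].
have zE : complex.Re z +i* complex.Im z = z by case: z {gx gy hx hy}.
split.
  have := is_cderiveM gx hx; rewrite zE; congr is_cderive; ring.
have := is_cderiveM gy hy; rewrite zE; congr is_cderive; ring.
Qed.

Lemma has_wirtingerX g z a b p : has_wirtinger g z a b ->
  has_wirtinger (fun w => g w ^+ p) z
    (p%:R * g z ^+ p.-1 * a) (p%:R * g z ^+ p.-1 * b).
Proof.
move=> dg; elim: p => [|p IH]; first by rewrite !mul0r; exact: has_wirtinger_cst.
have := has_wirtingerM dg IH.
have -> : (fun w => g w * g w ^+ p) = (fun w => g w ^+ p.+1).
  by apply/funext => w; rewrite exprS.
have E : g z * (p%:R * g z ^+ p.-1) = p%:R * g z ^+ p.
  by case: p {IH} => [|p]; rewrite ?mul0r ?mulr0 // mulrCA exprS.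
by congr has_wirtinger; rewrite mulrA E -natr1 /=; ring.
Qed.

Lemma has_wirtinger_sum (I : Type) (r : seq I) (g : I -> C -> C) z (a b : I -> C) :
  (forall i, has_wirtinger (g i) z (a i) (b i)) ->
  has_wirtinger (fun w => \sum_(i <- r) g i w) z
    (\sum_(i <- r) a i) (\sum_(i <- r) b i).
Proof.
move=> dg; elim: r => [|i r IH].
  rewrite !big_nil; have -> : (fun w => \sum_(i <- [::]) g i w) = fun=> 0.
    by apply/funext => w; rewrite big_nil.
  exact: has_wirtinger_cst.
rewrite !big_cons.
have -> : (fun w => \sum_(j <- i :: r) g j w) = (fun w => g i w + \sum_(j <- r) g j w).
  by apply/funext => w; rewrite big_cons.
exact: has_wirtingerD.
Qed.

End Wirtinger.

(** * Complex Hermite polynomials *)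

Section ComplexHermite.
Local Open Scope complex_scope.
Set Implicit Arguments.
Unset Strict Implicit.
Context {R : realType}.
Local Notation C := R[i].
Implicit Types z : C.

Definition complex_hermite_coef (m n k : nat) : C :=
  (-1) ^+ k * (k`! * 'C(m, k) * 'C(n, k))%:R.

(** The sum runs up to n instead of min(m, n): the extra terms vanish with
    'C(m, k), and a range that does not depend on m lets the lowering
    identities be checked term by term. *)
Definition complex_hermite (m n : nat) z : C :=
  \sum_(k < n.+1) complex_hermite_coef m n k * z ^+ (m - k) * conjc z ^+ (n - k).

Lemma has_wirtinger_complex_hermite m n z : has_wirtinger (complex_hermite m n) z
  (\sum_(k < n.+1)
    complex_hermite_coef m n k * ((m - k)%:R * z ^+ (m - k).-1) * conjc z ^+ (n - k))
  (\sum_(k < n.+1)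
    complex_hermite_coef m n k * z ^+ (m - k) * ((n - k)%:R * conjc z ^+ (n - k).-1)).
Proof.
apply: has_wirtinger_sum => k.
have := has_wirtingerM
  (has_wirtingerM (has_wirtinger_cst (complex_hermite_coef m n k) z)
    (has_wirtingerX (m - k) (has_wirtinger_id z)))
  (has_wirtingerX (n - k) (has_wirtinger_conj z)).
by congr has_wirtinger; ring.
Qed.

(** Coefficientwise this is (m - k) 'C(m, k) = m 'C(m - 1, k). *)
Lemma wirtinger_complex_hermite m n :
  wirtinger (complex_hermite m n) = fun z => m%:R * complex_hermite m.-1 n z.
Proof.
apply/funext => z; rewrite (has_wirtingerE (has_wirtinger_complex_hermite m n z)).
rewrite /complex_hermite big_distrr /=; apply: eq_bigr => k _.
have -> : (m.-1 - k = (m - k).-1)%N by rewrite -!subn1 subnAC.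
have E : ((m - k) * 'C(m, k) = m * 'C(m.-1, k))%N.
  by rewrite mul_bin_down.
have {}E := congr1 (fun x => x%:R : C) E; rewrite !natrM in E.
rewrite /complex_hermite_coef !natrM.
transitivity ((-1) ^+ k * k`!%:R * 'C(n, k)%:R * ((m - k)%:R * 'C(m, k)%:R) *
  z ^+ (m - k).-1 * conjc z ^+ (n - k)); first by ring.
by rewrite E; ring.
Qed.

(** Coefficientwise this is (n - k) 'C(n, k) = n 'C(n - 1, k), the top term
    k = n being constant in zbar. *)
Lemma wirtinger_bar_complex_hermite m n :
  wirtinger_bar (complex_hermite m n) = fun z => n%:R * complex_hermite m n.-1 z.
Proof.
apply/funext => z; rewrite (has_wirtinger_barE (has_wirtinger_complex_hermite m n z)).
case: n => [|n]; first by rewrite big_ord_recl big_ord0 /= mul0r mul0r mulr0 addr0.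
rewrite big_ord_recr /= subnn mul0r mulr0 addr0.
rewrite /complex_hermite big_distrr /=; apply: eq_bigr => k _.
have -> : (n - k = (n.+1 - k).-1)%N by rewrite -subn1 subnAC subn1.
have E : ((n.+1 - k) * 'C(n.+1, k) = n.+1 * 'C(n, k))%N.
  by rewrite mul_bin_down.
have {}E := congr1 (fun x => x%:R : C) E; rewrite !natrM in E.
rewrite /complex_hermite_coef !natrM.
transitivity ((-1) ^+ k * k`!%:R * 'C(m, k)%:R * ((n.+1 - k)%:R * 'C(n.+1, k)%:R) *
  z ^+ (m - k) * conjc z ^+ (n.+1 - k).-1); first by ring.
by rewrite E; ring.
Qed.

(** Pascal's rule splits 'C(n + 1, k) into two parts; the first gives zbar
    h_{m,n}, and k 'C(m, k) = m 'C(m - 1, k - 1) turns the second into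
    - m h_{m-1,n}. *)
Lemma complex_hermite_rec m n z :
  complex_hermite m n.+1 z =
    conjc z * complex_hermite m n z - m%:R * complex_hermite m.-1 n z.
Proof.
have c0 : complex_hermite_coef m n.+1 0 = complex_hermite_coef m n 0.
  by rewrite /complex_hermite_coef !bin0.
have cS k : complex_hermite_coef m n.+1 k.+1 =
    complex_hermite_coef m n k.+1 - m%:R * complex_hermite_coef m.-1 n k.
  have E : (k.+1 * 'C(m, k.+1) = m * 'C(m.-1, k))%N.
    by case: m {c0} => [|m]; [rewrite bin0n muln0 | rewrite mul_bin_diag].
  have {}E := congr1 (fun x => x%:R : C) E; rewrite !natrM in E.
  rewrite /complex_hermite_coef binS factS !natrM natrD.
  transitivity ((-1 : C) ^+ k.+1 * (k.+1%:R * k`!%:R) * 'C(m, k.+1)%:R * 'C(n, k.+1)%:R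
    - (-1 : C) ^+ k * k`!%:R * 'C(n, k)%:R * (k.+1%:R * 'C(m, k.+1)%:R)).
    by rewrite exprS; ring.
  by rewrite E; ring.
(* The top term k = n + 1 is absent from h_{m,n}: its coefficient has 'C(n, n + 1). *)
have cn : complex_hermite_coef m n n.+1 = 0.
  by rewrite /complex_hermite_coef (bin_small (ltnSn n)) muln0 mulr0.
rewrite /complex_hermite big_ord_recl /= c0.
under eq_bigr do rewrite cS.
under eq_bigr do rewrite !mulrBl.
rewrite sumrB addrA; congr (_ - _); last first.
  rewrite big_distrr; apply: eq_bigr => k _ /=.
  have -> : (m - bump 0 k = m.-1 - k)%N by rewrite /bump add1n -subn1 -subnDA add1n.
  by rewrite /bump add1n subSS; ring.
rewrite big_ord_recr /= [bump 0 n]/bump add1n cn !mul0r addr0.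
rewrite big_ord_recl /= mulrDr big_distrr /=; congr (_ + _).
  by rewrite !subn0 exprS; ring.
apply: eq_bigr => k _ /=; rewrite /bump add1n subSS.
have -> : (n - k = (n - k.+1).+1)%N by rewrite subnSK.
by rewrite exprS; ring.
Qed.

(** The first term is - n m h_{m-1,n-1} and the second n zbar h_{m,n-1}, so
    the recurrence closes the computation when n > 0; both vanish for n = 0. *)
Lemma complex_hermite_eigen m n z :
  - wirtinger (wirtinger_bar (complex_hermite m n)) z
    + conjc z * wirtinger_bar (complex_hermite m n) z
    = n%:R * complex_hermite m n z.
Proof.
have -> : wirtinger (wirtinger_bar (complex_hermite m n)) z =
    n%:R * (m%:R * complex_hermite m.-1 n.-1 z).
  have D := has_wirtingerM (has_wirtinger_cst n%:R z)
    (has_wirtinger_complex_hermite m n.-1 z).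
  rewrite wirtinger_bar_complex_hermite (has_wirtingerE D) mul0r add0r.
  congr (_ * _).
  by rewrite -(has_wirtingerE (has_wirtinger_complex_hermite m n.-1 z))
    wirtinger_complex_hermite.
rewrite wirtinger_bar_complex_hermite; case: n => [|n]; first by rewrite !mul0r; ring.
by rewrite complex_hermite_rec /=; ring.
Qed.

(** Applying dbar to an identically zero h_{m,n+1} would make (n + 1) h_{m,n}
    vanish identically, so non-vanishing climbs from h_{m,0} = z^m. *)
Lemma complex_hermite_neq0 m n : exists z, complex_hermite m n z != 0.
Proof.
elim: n => [|n [w hw]].
  exists 1; rewrite /complex_hermite big_ord_recl big_ord0
    /complex_hermite_coef !bin0 fact0 !subn0.
  by rewrite !expr1n expr0 !mulr1 addr0 oner_eq0.
apply: contrapT => no.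
have H0 : complex_hermite m n.+1 = fun=> 0.
  by apply/funext => z; apply/eqP; apply: contrapT => /negP nz; apply: no; exists z.
have := congr1 (fun g => wirtinger_bar g w) H0.
rewrite wirtinger_bar_complex_hermite (has_wirtinger_barE (has_wirtinger_cst 0 w)) /=.
by move/eqP; rewrite mulf_eq0 pnatr_eq0 (negbTE hw).
Qed.

End ComplexHermite.

(** * Reduction to the idempotent coordinates *)

Section Idempotent.
Local Open Scope complex_scope.
Set Implicit Arguments.
Unset Strict Implicit.
Context {R : realType}.
Local Notation BC := (bicomplex R).
Implicit Types (Z W : BC) (g : R[i] -> R[i]).

Lemma idem1_is_zmod_morphism : zmod_morphism (@idem1 R).
Proof. by move=> Z W; rewrite /idem1 /=; ring. Qed.
Lemma idem2_is_zmod_morphism : zmod_morphism (@idem2 R).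
Proof. by move=> Z W; rewrite /idem2 /=; ring. Qed.
(** The -1 coming from j^2 has to be read as i^2 for the product to factor. *)
Lemma idem1_is_monoid_morphism : monoid_morphism (@idem1 R).
Proof.
split=> [|Z W]; rewrite /idem1 /=; first by ring.
transitivity (bc1 Z * bc1 W + -1 * (bc2 Z * bc2 W) - 'i%C * (bc1 Z * bc2 W + bc2 Z * bc1 W)).
  by ring.
by rewrite -mulc_ii; ring.
Qed.
Lemma idem2_is_monoid_morphism : monoid_morphism (@idem2 R).
Proof.
split=> [|Z W]; rewrite /idem2 /=; first by ring.
transitivity (bc1 Z * bc1 W + -1 * (bc2 Z * bc2 W) + 'i%C * (bc1 Z * bc2 W + bc2 Z * bc1 W)).
  by ring.
by rewrite -mulc_ii; ring.
Qed.
HB.instance Definition _ := GRing.isZmodMorphism.Build BC R[i]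
  idem1 idem1_is_zmod_morphism.
HB.instance Definition _ := GRing.isMonoidMorphism.Build BC R[i]
  idem1 idem1_is_monoid_morphism.
HB.instance Definition _ := GRing.isZmodMorphism.Build BC R[i]
  idem2 idem2_is_zmod_morphism.
HB.instance Definition _ := GRing.isMonoidMorphism.Build BC R[i]
  idem2 idem2_is_monoid_morphism.

Lemma idem_inj Z W : idem1 Z = idem1 W -> idem2 Z = idem2 W -> Z = W.
Proof. by move=> E1 E2; rewrite -[Z]of_idemK -[W]of_idemK E1 E2. Qed.

(** Bicomplex functions acting by the same one-variable function on both
    idempotent coordinates; they are stable under the operators [d_dZ] and
    [d_dZstar], which makes iterating these operators immediate. *)
Definition bc_lift g Z : BC := of_idem (g (idem1 Z)) (g (idem2 Z)).

Lemma idem1_lift g l2 : (fun l => idem1 (bc_lift g (of_idem l l2))) = g.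
Proof. by apply/funext => l; rewrite /bc_lift !idem1K. Qed.

Lemma idem2_lift g l1 : (fun l => idem2 (bc_lift g (of_idem l1 l))) = g.
Proof. by apply/funext => l; rewrite /bc_lift !idem2K. Qed.

Lemma d_dZ_lift g : d_dZ (bc_lift g) = bc_lift (wirtinger g).
Proof. by apply/funext => Z; rewrite /d_dZ idem1_lift idem2_lift. Qed.

Lemma d_dZstar_lift g : d_dZstar (bc_lift g) = bc_lift (wirtinger_bar g).
Proof. by apply/funext => Z; rewrite /d_dZstar idem1_lift idem2_lift. Qed.

Lemma landau_lift g : landau (bc_lift g) =
  bc_lift (fun z => - wirtinger (wirtinger_bar g) z + conjc z * wirtinger_bar g z).
Proof.
apply/funext => Z; rewrite /landau /laplacian_k d_dZstar_lift d_dZ_lift.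
by apply: idem_inj; rewrite rmorphD rmorphN rmorphM /= bc_conjE !(idem1K, idem2K).
Qed.

(** The coefficients are integers, so only the action of the morphism on the
    star-conjugate matters. *)
Lemma rmorph_hermite (f : {rmorphism BC -> R[i]}) m n Z :
  f (bc_conj Z) = conjc (f Z) -> f (hermite m n Z) = complex_hermite m n (f Z).
Proof.
move=> fJ.
have -> : hermite m n Z = \sum_(k < n.+1)
    (-1) ^+ k * (k`! * 'C(m, k) * 'C(n, k))%:R * Z ^+ (m - k) * bc_conj Z ^+ (n - k).
  rewrite /hermite (big_ord_widen n.+1 (fun k => (-1) ^+ k *
    (k`! * 'C(m, k) * 'C(n, k))%:R * Z ^+ (m - k) * bc_conj Z ^+ (n - k)));
    last by rewrite ltnS geq_minr.
  rewrite big_mkcond; apply: eq_bigr => k _; case: ifPn => //.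
  have kn : (k <= n)%N by rewrite -ltnS.
  rewrite ltnS leq_min kn andbT -ltnNge => /bin_small ->.
  by rewrite muln0 mul0n mulr0 !mul0r.
rewrite rmorph_sum; apply: eq_bigr => k _.
by rewrite 3!rmorphM !rmorphXn rmorphN1 rmorph_nat fJ.
Qed.

Lemma hermite_lift m n : @hermite R m n = bc_lift (complex_hermite m n).
Proof.
apply/funext => Z; apply: idem_inj; rewrite /bc_lift ?idem1K ?idem2K.
  have H : idem1 (bc_conj Z) = conjc (idem1 Z) by rewrite bc_conjE idem1K.
  exact: (rmorph_hermite (f := idem1) m n H).
have H : idem2 (bc_conj Z) = conjc (idem2 Z) by rewrite bc_conjE idem2K.
exact: (rmorph_hermite (f := idem2) m n H).
Qed.

End Idempotent.

Theorem theorem5p16 (R : realType) (m n : nat) :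
  eigenfunction (@landau R) n%:R (@hermite R m n).
Proof.
split; first exact: bc_smooth_hermite.
  have [w hw] := @complex_hermite_neq0 R m n.
  exists (of_idem w w); apply: contraNneq hw => H0.
  have := congr1 idem1 H0.
  by rewrite hermite_lift /bc_lift !idem1K rmorph0 => ->.
move=> Z; rewrite hermite_lift landau_lift; apply: idem_inj.
  rewrite /bc_lift idem1K complex_hermite_eigen rmorphM.
  by rewrite rmorph_nat /= idem1K.
by rewrite /bc_lift idem2K complex_hermite_eigen rmorphM rmorph_nat /= idem2K.
Qed.
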